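(* Let $G$ be a finite non-abelian group, let $H$ be a subgroup of $G$ with $H \neq Z(H,G)$, and let $g \in K(H,G)$. If $g \neq 1$, then $\Gamma_{H,G}^g$ is a star if and only if $G \cong S_3$ and $|H| = 2$.
   Context: For $x,y$ in a group, $[x,y] = x^{-1}y^{-1}xy$. For a subgroup $H$ of $G$: $Z(H,G) = \{x \in H : xy = yx \text{ for all } y \in G\}$ and $K(H,G) = \{[x,y] : x \in H,\ y \in G\}$. The relative $g$-noncommuting graph $\Gamma_{H,G}^g$ is the simple undirected graph with vertex set $G$ in which two distinct vertices $x,y$ are adjacent if and only if ($x \in H$ or $y \in H$) and $[x,y] \neq g$ and $[x,y] \neq g^{-1}$. A star is a complete bipartite graph $K_{1,n}$. $S_3$ is the symmetric group on three letters. *)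

(* Defs.v *)
From HB Require Import structures.
From mathcomp Require Import all_boot all_fingroup.

Set Implicit Arguments.
Unset Strict Implicit.
Unset Printing Implicit Defensive.

Import GroupScope.

(* Finite simple undirected graphs. *)
Record sgraph := SGraph {
  vertex : finType;
  edge : rel vertex;
  edge_sym : symmetric edge;
  edge_irrefl : irreflexive edge
}.

Definition graph_iso (A B : sgraph) : Prop :=
  exists2 f : vertex A -> vertex B,
    bijective f & forall x y, edge (f x) (f y) = edge x y.

Definition bip_edge (m n : nat) : rel ('I_m + 'I_n)%type :=
  fun u v => match u, v with
             | inl _, inr _ | inr _, inl _ => true
             | _, _ => false
             end.

Lemma bip_edge_sym m n : symmetric (@bip_edge m n).
Proof. by case=> ? [] ?. Qed.

Lemma bip_edge_irrefl m n : irreflexive (@bip_edge m n).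
Proof. by case. Qed.

Definition complete_bipartite (m n : nat) : sgraph :=
  SGraph (@bip_edge_sym m n) (@bip_edge_irrefl m n).

Definition is_star (A : sgraph) : Prop :=
  exists n : nat, graph_iso A (complete_bipartite 1 n).

Section RelativeNoncommutingGraph.

Variables (gT : finGroupType) (G H : {group gT}) (g : gT).

Definition rnc_edge : rel (subg_of G) :=
  fun u v => let x := sgval u in let y := sgval v in
    [&& x != y, (x \in H) || (y \in H), [~ x, y] != g & [~ x, y] != g^-1].

Lemma rnc_edge_sym : symmetric rnc_edge.
Proof.
move=> u v; rewrite /rnc_edge /= eq_sym orbC -(invg_comm (sgval v)).
by rewrite (inv_eq invgK) eqg_inv [X in _ && (_ && X)]andbC.
Qed.

Lemma rnc_edge_irrefl : irreflexive rnc_edge.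
Proof. by move=> u; rewrite /rnc_edge /= eqxx. Qed.

(* The graph $\Gamma_{H,G}^g$; its vertex set is G itself, as the subtype
   subg_of G. *)
Definition rnc_graph : sgraph := SGraph rnc_edge_sym rnc_edge_irrefl.

End RelativeNoncommutingGraph.

(* Main.v *)
Require Import Defs.
From HB Require Import structures.
From mathcomp Require Import all_boot all_fingroup all_solvable.

(** Since g != 1, the identity is joined in the graph to every other vertex: it
    commutes with everything. As G is non-abelian it has more than two elements,
    so a star can only be centred at 1, and the graph is a star exactly when no
    two nontrivial elements are adjacent ([rnc_starP]). In other words, for
    distinct nontrivial x in H and y in G, [~ x, y] must be g or g^-1.

    Such x and y then never commute, so 'C_G[h] = {1, h} for each nontrivial h
    in H. Hence the elements of H are involutions, H is abelian, and H = {1, h}.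
    Moreover every conjugate h ^ y = h * [~ h, y] is one of h, h * g, h * g^-1.
    The class of h has |G| / 2 elements, whence |G| <= 6; but a non-abelian group
    has order at least 6, and the only one of order 6 is S_3 ([isog_S3P]).

    Conversely, in a non-abelian group of order 6 an involution h is the only
    nontrivial element of its centraliser ([cent1_involution_2p]), so its class
    has three elements. If g = [~ h, y] != 1 then g^-1 = [~ h, y * h] differs from
    g, so the class is {h, h * g, h * g^-1} and every [~ h, z] other than 1 is g
    or g^-1; it is 1 only if z is 1 or h. *)

Set Implicit Arguments.
Unset Strict Implicit.
Unset Printing Implicit Defensive.

Import GroupScope.

(** Speaking of a star through its centre c, by saying that an edge is a pair
    with exactly one end equal to c, removes the isomorphism with a model graph.
    Conversely c goes to the unique left vertex, and the other vertices are
    enumerated on the right. *)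
Lemma is_starP (A : sgraph) :
  is_star A <->
  exists c : vertex A, forall x y, edge x y = (x == c) (+) (y == c).
Proof.
split=> [[n [f [f' fK f'K] fE]] | [c cE]].
  have centerE x : (x == f' (inl ord0)) = if f x is inl _ then true else false.
    rewrite -(can_eq fK) f'K; case: (f x) => [i|//]; by rewrite (ord1 i) eqxx.
  exists (f' (inl ord0)) => x y; rewrite -fE !centerE.
  by case: (f x) (f y) => [?|?] [?|?].
pose L := {x : vertex A | x != c}.
pose f x : 'I_1 + 'I_#|{: L}| :=
  if insub x is Some u then inr (enum_rank (u : L)) else inl ord0.
pose f' (i : 'I_1 + 'I_#|{: L}|) :=
  if i is inr j then val (enum_val j) else c.
exists #|{: L}|, f => [|x y].
  exists f' => [x | [i|j]].
  - rewrite /f; case: insubP => [u _ <-|]; first by rewrite /= enum_rankK.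
    by rewrite negbK => /eqP->.
  - by rewrite /f /= insubF ?eqxx // (ord1 i).
  - by rewrite /f /= valK enum_valK.
rewrite cE /f.
by case: insubP => [u /negPf-> _|/negPn->]; case: insubP => [v /negPf-> _|/negPn->].
Qed.

(** The vertex 1 is joined to all the others because [~ 1, y] = 1 is neither g
    nor g^-1. If the centre c of a star were not 1, then any third vertex would be
    joined to 1, an edge that avoids c; so c = 1, and being a star means that there
    is no edge away from 1. *)
Lemma rnc_starP (gT : finGroupType) (G H : {group gT}) (g : gT) :
    H \subset G -> 2 < #|G| -> g != 1 ->
  is_star (rnc_graph G H g) <->
  {in H^# & G^#, forall x y, x != y -> [~ x, y] \in [set g; g^-1]}.
Proof.
move=> sHG gt2G ntg.
have edge1 (u v : subg_of G) : u = 1 -> rnc_edge H g u v = (v != 1).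
  move=> ->; rewrite /rnc_edge /= comm1g group1 ![1 == _]eq_sym invg_eq1.
  by rewrite (negPf ntg) /= andbT; congr (~~ _).
split=> [/is_starP[c /= cE] x y | adjP].
  (* Otherwise every vertex is 1 or c, against 2 < #|G|. *)
  have c1: c = 1.
    apply: contraTeq gt2G => nt_c; rewrite -leqNgt.
    apply: leq_trans (_ : #|[set 1; sgval c]| <= 2); last first.
      by rewrite cards2; case: (_ == _).
    apply/subset_leq_card/subsetP=> z Gz; rewrite !inE.
    have := cE 1 (Subg Gz); rewrite edge1 // [1 == c]eq_sym (negPf nt_c) /=.
    by rewrite -!val_eqE /= => <-; rewrite orbN.
  rewrite !inE => /andP[ntx Hx] /andP[nty Gy] neq_xy.
  have := cE (Subg (subsetP sHG x Hx)) (Subg Gy).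
  rewrite c1 -!val_eqE /= (negPf ntx) (negPf nty) /rnc_edge /= neq_xy Hx /=.
  by move/negbT; rewrite negb_and !negbK.
apply/is_starP; exists 1 => u v /=.
have [u1 | ntu] := eqVneq u 1; first by rewrite edge1.
have [v1 | ntv] := eqVneq v 1; first by rewrite rnc_edge_sym edge1 // ntu.
have adj0 (a b : subg_of G) : a != 1 -> b != 1 -> sgval a \in H ->
    rnc_edge H g a b = false.
  move=> nta ntb Ha; rewrite /rnc_edge Ha /= -negb_or.
  have [//|neq_ab /=] := eqVneq (sgval a) (sgval b).
  apply/negbF; have := @adjP (sgval a) (sgval b); rewrite !inE; apply=> //.
    by rewrite Ha andbT.
  by rewrite subgP andbT.
(* An edge needs an end in H, and by symmetry either end can be the first
   argument of the commutator. *)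
have [Hu | nHu] := boolP (sgval u \in H); first by rewrite adj0.
have [Hv | nHv] := boolP (sgval v \in H); first by rewrite rnc_edge_sym adj0.
by rewrite /rnc_edge (negPf nHu) (negPf nHv) andbF.
Qed.


Lemma card_nonabelian_ge6 (gT : finGroupType) (G : {group gT}) :
  ~~ abelian G -> 5 < #|G|.
Proof.
apply: contraR; rewrite -leqNgt => leG5.
have pr_ab: prime #|G| -> abelian G by move/prime_cyclic/cyclic_abelian.
have G_gt0 := cardG_gt0 G.
case oG: #|G| leG5 G_gt0 => [|[|[|[|[|[|n]]]]]] // _ _; rewrite ?oG in pr_ab.
- by rewrite (card1_trivg oG) abelian1.
- exact: pr_ab.
- exact: pr_ab.
- exact: (@card_p2group_abelian _ 2).
- exact: pr_ab.
Qed.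

(** The index of <[h]> in G is prime, so no subgroup lies strictly between. *)
Lemma involution_max_2p (gT : finGroupType) (G D : {group gT}) p h :
    prime p -> #|G| = p.*2 -> #[h] = 2 -> h \in D -> D \subset G ->
  D :=: <[h]> \/ D :=: G.
Proof.
move=> p_pr oG oh Dh sDG.
have /dvdnP[k oD]: 2 %| #|D| by rewrite -oh order_dvdG.
have: k %| p by rewrite -(@dvdn_pmul2r 2) // -oD muln2 -oG cardSg.
case/(primeP p_pr).2/orP=> /eqP Dk; [left; apply/esym | right];
  apply/eqP; rewrite eqEcard oD Dk.
  by rewrite cycle_subG Dh -orderE oh.
by rewrite sDG oG muln2 leqnn.
Qed.

(** By maximality of <[h]>, a larger centraliser would be all of G; the centre
    would then contain h, and the quotient by it, of order 1 or p, would be cyclic,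
    which forces G to be abelian. *)
Lemma cent1_involution_2p (gT : finGroupType) (G : {group gT}) p h :
    prime p -> #|G| = p.*2 -> ~~ abelian G -> h \in G -> #[h] = 2 ->
  'C_G[h] = <[h]>.
Proof.
move=> p_pr oG nabG Gh oh.
have Ch: h \in 'C_G[h] by rewrite inE Gh cent1id.
have [//|/= CG] := involution_max_2p p_pr oG oh Ch (subsetIl _ _).
case/negP: nabG; apply: cyclic_center_factor_abelian.
have Zh: h \in 'Z(G).
  by rewrite inE Gh -sub_cent1 -CG subsetIr.
have [Zeq | ->] := involution_max_2p p_pr oG oh Zh (center_sub G); last first.
  by rewrite trivg_quotient cyclic1.
apply: prime_cyclic; rewrite card_quotient ?normal_norm ?center_normal //.
by rewrite -divgS ?center_sub // Zeq -orderE oh oG -muln2 mulnK.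
Qed.

(** An involution h and a conjugate of it other than h generate G, since <[h]> is
    maximal, and a group generated by two distinct involutions is dihedral. *)
Lemma nonabelian_2p_isog_dihedral (gT : finGroupType) (G : {group gT}) p :
    prime p -> #|G| = p.*2 -> ~~ abelian G -> G \isog [set: 'D_(p.*2)].
Proof.
move=> p_pr oG nabG.
have [h Gh oh]: {h | h \in G & #[h] = 2}.
  by apply: Cauchy; rewrite // oG -muln2 dvdn_mull.
have [y Gy ntc]: exists2 y, y \in G & h ^ y != h.
  apply/exists_inP; apply: contraR (nabG); rewrite negb_exists_in.
  move/forall_inP=> cGh; have <-: 'C_G[h] = G.
    apply/setIidPl/subsetP=> y Gy; apply/cent1P/commute_sym/commgP/conjg_fixP.
    by apply/eqP; have:= cGh y Gy; rewrite negbK.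
  by rewrite (cent1_involution_2p p_pr oG nabG Gh oh) cycle_abelian.
have ohy: #[h ^ y] = 2 by rewrite orderJ.
have := involutions_gen_dihedral oh ohy; rewrite eq_sym ntc => /(_ isT).
set D := <<_>>; have [sDh sDhy]: h \in D /\ h ^ y \in D.
  by rewrite !mem_gen ?inE ?eqxx ?orbT.
have sDG: D \subset G by rewrite gen_subG subUset !sub1set Gh groupJ.
have [/= DE | /= ->] := involution_max_2p (D := [group of D]) p_pr oG oh sDh sDG.
  move: sDhy; rewrite DE cycle2g // !inE (negPf ntc) orbF.
  by rewrite conjg_eq1 => /eqP h1; rewrite h1 order1 in oh.
by rewrite oG.
Qed.

(** Both G and 'S_3 are then dihedral of order 6, which avoids constructing an
    action of G on three points. *)
Lemma isog_S3P (gT : finGroupType) (G : {group gT}) :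
  ~~ abelian G -> (G \isog [set: 'S_3]) = (#|G| == 6).
Proof.
move=> nabG; have oS3: #|[set: 'S_3]| = 6 by rewrite cardsT card_Sn.
have nabS3: ~~ abelian [set: 'S_3].
  pose s := tperm (@Ordinal 3 0 isT) (@Ordinal 3 1 isT).
  pose t := tperm (@Ordinal 3 1 isT) (@Ordinal 3 2 isT).
  apply/negP=> /centsP/(_ s (in_setT _) t (in_setT _)) /permP/(_ ord0).
  by rewrite !permM /s /t; do !rewrite permE /=.
apply/idP/eqP=> [/card_isog-> // | oG].
apply: isog_trans (nonabelian_2p_isog_dihedral (p := 3) _ _ nabG) _ => //.
by rewrite isog_sym; apply: nonabelian_2p_isog_dihedral.
Qed.

Theorem theorem2p9 (gT : finGroupType) (G H : {group gT}) (g : gT)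
    (nabG : ~~ abelian G) (sHG : H \subset G)
    (ntHZ : H :!=: 'C_H(G)) (gK : g \in commg_set H G) (ntg : g != 1) :
  is_star (rnc_graph G H g) <-> (G \isog [set: 'S_3] /\ #|H| = 2).
Proof.
have G_gt5 := card_nonabelian_ge6 nabG.
(* Conjugates of h are read off from commutators, and conversely. *)
have conjE (h y : gT) : h ^ y = h * [~ h, y] by rewrite commgEl mulKVg.
apply: iff_trans (rnc_starP sHG (leq_trans _ G_gt5) ntg) _ => //.
rewrite isog_S3P //; split=> [adjP | [/eqP oG oH]].
  have centE h : h \in H^# -> 'C_G[h] = [set 1; h].
    move=> Hh; have /setD1P[nth Hh1] := Hh; have Gh := subsetP sHG h Hh1.
    apply/setP=> y; rewrite in_setI in_set2; apply/andP/idP => [[Gy /cent1P chy] | ].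
      apply: contraT; rewrite negb_or => /andP[nty neq_yh].
      have := adjP h y Hh; rewrite !inE nty Gy eq_sym neq_yh => /(_ isT isT).
      rewrite (_ : [~ h, y] = 1); last exact/eqP/commgP/commute_sym.
      by rewrite ![1 == _]eq_sym invg_eq1 (negPf ntg).
    by case/orP=> /eqP->; rewrite ?cent1id ?Gh ?group1.
  have invE h : h \in H -> h^-1 = h.
    move=> Hh; have [->|nth] := eqVneq h 1; first exact: invg1.
    have: h^-1 \in 'C_G[h] by rewrite inE groupV (subsetP sHG) //= groupV cent1id.
    by rewrite centE ?inE ?nth // invg_eq1 (negPf nth) => /eqP.
  have [h Hh]: exists h, h \in H^#.
    apply/set0Pn; rewrite setD_eq0 subG1; apply: contraNneq ntHZ => ->.
    by rewrite (setIidPl (sub1G _)).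
  have /setD1P[nth Hh1] := Hh; have Gh := subsetP sHG h Hh1.
  have HE: H :=: [set 1; h].
    apply/eqP; rewrite eqEsubset subUset !sub1set group1 Hh1 /= andbT -centE //.
    apply/subsetP=> x Hx; rewrite inE (subsetP sHG) //=; apply/cent1P.
    by rewrite /commute -[x * h]invE ?groupM // invMg !invE.
  have oH: #|H| = 2 by rewrite HE cards2 eq_sym nth.
  split=> //.
  have sclass: h ^: G \subset [set h; h * g; h * g^-1].
    apply/subsetP=> _ /imsetP[y Gy ->]; rewrite !inE.
    have [-> | neq_hy] := eqVneq h y; first by rewrite conjE commgg mulg1 eqxx.
    have [-> | nty] := eqVneq y 1; first by rewrite conjg1 eqxx.
    have := adjP h y Hh; rewrite !inE nty Gy => /(_ isT neq_hy).
    by rewrite conjE; case/orP=> /eqP->; rewrite eqxx ?orbT.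
  (* |G| is the order 2 of 'C_G[h] times the size of the class of h. *)
  have le6: #|G| <= 3 * 2.
    rewrite -(Lagrange (subsetIl G 'C[h])) index_cent1 /= centE // -HE oH mulnC.
    rewrite leq_mul2r (leq_trans (subset_leq_card sclass)) //.
    by rewrite -setUA cardsU1 cards2; case: (_ \notin _); case: (_ != _).
  by rewrite eqn_leq le6.
have [h [y [Hh Gy gE]]]: exists h y, [/\ h \in H, y \in G & g = [~ h, y]].
  by case/imset2P: gK => h y Hh Gy ->; exists h, y.
have nth: h != 1 by apply: contraNneq ntg => h1; rewrite gE h1 comm1g.
have HE: H :=: [set 1; h].
  apply/esym/eqP; rewrite eqEcard subUset !sub1set group1 Hh.
  by rewrite oH cards2 eq_sym nth.
have Gh := subsetP sHG h Hh.
have oh: #[h] = 2.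
  apply/eqP; rewrite eqn_leq order_gt1 nth -oH andbT.
  by rewrite dvdn_leq ?cardG_gt0 ?order_dvdG.
have hK: h^-1 = h by apply/eqP; rewrite eq_invg_mul -[h * h]/(h ^+ 2) -oh expg_order.
have centE: 'C_G[h] = [set 1; h] by rewrite (@cent1_involution_2p _ _ 3) ?cycle2g.
(* h * (h ^ y) is a product of two involutions, hence inverted by each of them. *)
have gJ: g ^ h = g^-1.
  rewrite gE commgEl invMg -conjVg hK; set a := h ^ y.
  by rewrite conjgE hK -!mulgA -{1}hK mulKg.
have gV: g^-1 = [~ h, y * h] by rewrite commgMJ commgg mul1g -gE gJ.
(* If g = g^-1 then h centralises g, so g = h and h ^ y = h * h = 1. *)
have neq_gV: g != g^-1.
  apply: contra_neq ntg => gVg; have: g \in 'C_G[h].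
    rewrite inE cent1C (introT cent1P) ?andbT; last first.
      by apply/commute_sym/commgP/conjg_fixP; rewrite gJ.
    by rewrite gE groupR.
  rewrite centE !inE => /orP[/eqP// | /eqP gh].
  have := conjE h y; rewrite -gE gh -{2}hK mulVg => /eqP.
  by rewrite conjg_eq1 (negPf nth).
have eq_mulgl k : (h * k == h) = (k == 1).
  by rewrite -{2}[h]mulg1 (inj_eq (mulgI h)).
have classE: h ^: G = [set h; h * g; h * g^-1].
  apply/esym/eqP; rewrite eqEcard; apply/andP; split.
    rewrite !subUset !sub1set class_refl {1}gE gV -!conjE.
    by rewrite !memJ_class ?groupM.
  rewrite -index_cent1 -divgS ?subsetIl //= centE oG cards2 eq_sym nth.
  rewrite -setUA cardsU1 cards2 !inE (inj_eq (mulgI h)) neq_gV.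
  by rewrite ![h == _]eq_sym !eq_mulgl invg_eq1 (negPf ntg).
move=> x z; rewrite HE !inE => /andP[ntx /orP[|]]; first by rewrite (negPf ntx).
move=> /eqP-> /andP[ntz Gz] neq_hz.
have : h ^ z \in h ^: G by rewrite memJ_class.
rewrite conjE classE !inE eq_mulgl !(inj_eq (mulgI h)) -orbA.
case/orP=> [/commgP chz | //].
have: z \in 'C_G[h] by rewrite inE Gz; apply/cent1P/commute_sym.
by rewrite centE !inE (negPf ntz) eq_sym (negPf neq_hz).
Qed.
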